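(* Let $((\mathcal{A}_n),(\varphi_{j,i}))$ be an inductive system of unital Banach algebras, indexed by $\mathbb N$. Then there is an isometric unital algebra homomorphism $\theta:\varinjlim\mathcal{A}_n\to\mathrm{Asy}(\mathcal{A}_n)$.
   Context: Banach algebras are complex and have a contractive product $\|ab\|\le\|a\|\|b\|$; a unital Banach algebra has unit $1$ with $\|1\|=1$. For a sequence $(\mathcal A_n)$ of Banach algebras, $\ell^\infty(\mathcal A_n)$ is the Banach algebra of all bounded sequences $(a_n)$ with $a_n\in\mathcal A_n$, with pointwise operations and the supremum norm; $c_0(\mathcal A_n)$ is the closed two-sided ideal of sequences with $\lim_{n\to\infty}\|a_n\|=0$; and $\mathrm{Asy}(\mathcal A_n)=\ell^\infty(\mathcal A_n)/c_0(\mathcal A_n)$ with the quotient norm. An inductive system of unital Banach algebras indexed by $\mathbb N$ consists of unital Banach algebras $(\mathcal A_n)_{n\in\mathbb N}$ and, for $i\le j$, bounded unital homomorphisms $\varphi_{j,i}:\mathcal A_i\to\mathcal A_j$ with $\varphi_{i,i}=\mathrm{id}$, $\varphi_{k,j}\circ\varphi_{j,i}=\varphi_{k,i}$ for $i\le j\le k$, and $\limsup_{j\ge i}\|\varphi_{j,i}\|<\infty$ for each $i$. Its (Banach algebra) inductive limit $\mathcal A=\varinjlim\mathcal A_n$ is the unital Banach algebra characterised, uniquely up to isometric isomorphism, by: (1) for each $i$ there is a bounded unital homomorphism $\varphi_i:\mathcal A_i\to\mathcal A$ with $\|\varphi_i(a)\|\le\limsup_{j\ge i}\|\varphi_{j,i}(a)\|$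 for all $a\in\mathcal A_i$; (2) $\varphi_i=\varphi_j\circ\varphi_{j,i}$ for $i\le j$; (3) if $\mathcal B$ is a unital Banach algebra with bounded unital homomorphisms $\phi_i:\mathcal A_i\to\mathcal B$ such that $\phi_i=\phi_j\circ\varphi_{j,i}$ for $i\le j$ and $\|\phi_i(a)\|\le\limsup_{j\ge i}\|\varphi_{j,i}(a)\|$ for all $i$ and $a\in\mathcal A_i$, then there is a unique contractive unital homomorphism $\phi:\mathcal A\to\mathcal B$ with $\phi\circ\varphi_i=\phi_i$ for each $i$. Equivalently, $\mathcal A$ is the completion of the union of the images $\varphi_i(\mathcal A_i)$, where $\|\varphi_i(a)\|=\limsup_{j\ge i}\|\varphi_{j,i}(a)\|$. *)

(* Defs.v *)
From HB Require Import structures.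
From mathcomp Require Import all_boot all_order all_algebra.
From mathcomp Require Import generic_quotient ring_quotient complex.
From mathcomp Require Import boolp classical_sets reals ereal topology.
From mathcomp Require Import normedtype sequences.

Set Implicit Arguments.
Unset Strict Implicit.
Unset Printing Implicit Defensive.

Import Order.TTheory GRing.Theory Num.Theory.
Import numFieldNormedType.Exports.

Local Open Scope classical_set_scope.
Local Open Scope complex_scope.
Local Open Scope ring_scope.

(* Num.NumDomain already contains both a ring and a norm, so no structure can
   join GRing.Algebra with NormedModule.  The product is therefore added to a
   complete normed module, and the library's algebra structure is derived from
   it below: on A : unitalBanachAlgType K, x * y is bmul x y and 1 is bone. *)
HB.mixin Record CompleteNormedModule_isUnitalBanachAlgebra (K : numFieldType) A
    of CompleteNormedModule K A := {
  bmul : A -> A -> A ;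
  bone : A ;
  bmulA : associative bmul ;
  bmul1l : left_id bone bmul ;
  bmul1r : right_id bone bmul ;
  bmulDl : left_distributive bmul +%R ;
  bmulDr : right_distributive bmul +%R ;
  bscaleAl : forall (k : K) (x y : A), k *: bmul x y = bmul (k *: x) y ;
  bscaleAr : forall (k : K) (x y : A), k *: bmul x y = bmul x (k *: y) ;
  bnormM : forall x y : A, `|bmul x y| <= `|x| * `|y| ;
  bnorm1 : `|bone| = 1
}.

#[short(type="unitalBanachAlgType")]
HB.structure Definition UnitalBanachAlgebra (K : numFieldType) :=
  {A of CompleteNormedModule K A
      & CompleteNormedModule_isUnitalBanachAlgebra K A}.

Section UnitalBanachAlgebraTheory.
Context (K : numFieldType) (A : unitalBanachAlgType K).
Local Notation T := (@UnitalBanachAlgebra.sort K A).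

Let bone_neq0 : (bone : A) != 0.
Proof.
apply/eqP => /(congr1 Num.norm); rewrite bnorm1 normr0 => /eqP.
by rewrite oner_eq0.
Qed.
HB.instance Definition _ := GRing.Zmodule_isNzRing.Build T
  bmulA bmul1l bmul1r bmulDl bmulDr bone_neq0.
HB.instance Definition _ := GRing.Lmodule_isLalgebra.Build K T bscaleAl.
HB.instance Definition _ := GRing.Lalgebra_isAlgebra.Build K T bscaleAr.

Lemma normrM_le (x y : A) : `|x * y| <= `|x| * `|y|.
Proof. exact: bnormM. Qed.

Lemma normr_one : `|1 : A| = 1.
Proof. exact: bnorm1. Qed.

End UnitalBanachAlgebraTheory.

(* The norm of a normed space over R[i] takes its values in R[i]; these values
   are nonnegative reals, and rnorm reads them in R. *)
Definition rnorm (R : realType) (V : normedModType R[i]) (x : V) : R :=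
  complex.Re `|x|.

Section RealNorm.
Context (R : realType) (V : normedModType R[i]).
Implicit Types x y : V.

Lemma rnormE x : `|x| = (rnorm x)%:C.
Proof. by rewrite /rnorm RRe_real // ger0_real. Qed.

Lemma rnorm_ge0 x : 0 <= rnorm x.
Proof. by rewrite -(@lecR R) -rnormE normr_ge0. Qed.

Lemma rnorm0 : rnorm (0 : V) = 0.
Proof. by rewrite /rnorm normr0. Qed.

Lemma rnorm_eq0 x : rnorm x = 0 -> x = 0.
Proof. by move=> x0; apply/normr0_eq0; rewrite rnormE x0. Qed.

Lemma rnormN x : rnorm (- x) = rnorm x.
Proof. by rewrite /rnorm normrN. Qed.

Lemma rnormD x y : rnorm (x + y) <= rnorm x + rnorm y.
Proof. by rewrite -(@lecR R) rmorphD /= -!rnormE ler_normD. Qed.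

Lemma normcE (k : R[i]) : `|k| = (complex.Re `|k|)%:C.
Proof. by rewrite RRe_real. Qed.

Lemma Re_norm_ge0 (k : R[i]) : 0 <= complex.Re `|k|.
Proof. by rewrite -(@lecR R) -normcE normr_ge0. Qed.

Lemma rnormZ (k : R[i]) x : rnorm (k *: x) = complex.Re `|k| * rnorm x.
Proof.
by apply: (@complexI R); rewrite rmorphM /= -!rnormE -normcE normrZ.
Qed.

End RealNorm.

Lemma rnormM (R : realType) (A : unitalBanachAlgType R[i]) (x y : A) :
  rnorm (x * y) <= rnorm x * rnorm y.
Proof. by rewrite -(@lecR R) rmorphM /= -!rnormE normrM_le. Qed.

Lemma rnorm1 (R : realType) (A : unitalBanachAlgType R[i]) :
  rnorm (1 : A) = 1.
Proof. by rewrite /rnorm normr_one. Qed.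

Definition seqprod (R : realType) (A : nat -> unitalBanachAlgType R[i]) : Type :=
  forall n, A n.

Section SeqProd.
Context (R : realType) (A : nat -> unitalBanachAlgType R[i]).
Local Notation T := (seqprod A).
Implicit Types x y z : T.

HB.instance Definition _ := gen_eqMixin T.
HB.instance Definition _ := gen_choiceMixin T.

Let add x y : T := fun n => x n + y n.
Let opp x : T := fun n => - x n.
Let zero : T := fun=> 0.
Let mul x y : T := fun n => x n * y n.
Let one : T := fun=> 1.
Let scale (k : R[i]) x : T := fun n => k *: x n.

Let addA : associative add.
Proof. by move=> x y z; apply: functional_extensionality_dep => n; exact: addrA. Qed.
Let addC : commutative add.
Proof. by move=> x y; apply: functional_extensionality_dep => n; exact: addrC. Qed.
Let add0 : left_id zero add.
Proof. by move=> x; apply: functional_extensionality_dep => n; exact: add0r. Qed.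
Let addN : left_inverse zero opp add.
Proof. by move=> x; apply: functional_extensionality_dep => n; exact: addNr. Qed.
HB.instance Definition _ := GRing.isZmodule.Build T addA addC add0 addN.

Let mulA : associative mul.
Proof. by move=> x y z; apply: functional_extensionality_dep => n; exact: mulrA. Qed.
Let mul1l : left_id one mul.
Proof. by move=> x; apply: functional_extensionality_dep => n; exact: mul1r. Qed.
Let mul1r' : right_id one mul.
Proof. by move=> x; apply: functional_extensionality_dep => n; exact: mulr1. Qed.
Let mulDl : left_distributive mul +%R.
Proof. by move=> x y z; apply: functional_extensionality_dep => n; exact: mulrDl. Qed.
Let mulDr : right_distributive mul +%R.
Proof. by move=> x y z; apply: functional_extensionality_dep => n; exact: mulrDr. Qed.
Let one_neq0 : one != 0.
Proof.
apply/eqP => /(congr1 (fun x : T => x 0%N)) /eqP.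
by apply/negP; exact: oner_neq0.
Qed.
HB.instance Definition _ := GRing.Zmodule_isNzRing.Build T
  mulA mul1l mul1r' mulDl mulDr one_neq0.

Let scaleA k l x : scale k (scale l x) = scale (k * l) x.
Proof. by apply: functional_extensionality_dep => n; exact: scalerA. Qed.
Let scale1 : left_id 1 scale.
Proof. by move=> x; apply: functional_extensionality_dep => n; exact: scale1r. Qed.
Let scaleDr : right_distributive scale +%R.
Proof. by move=> k x y; apply: functional_extensionality_dep => n; exact: scalerDr. Qed.
Let scaleDl x : {morph scale^~ x : k l / k + l}.
Proof. by move=> k l; apply: functional_extensionality_dep => n; exact: scalerDl. Qed.
HB.instance Definition _ := GRing.Zmodule_isLmodule.Build R[i] T
  scaleA scale1 scaleDr scaleDl.

Let scaleAl (k : R[i]) x y : k *: (x * y) = (k *: x) * y.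
Proof. by apply: functional_extensionality_dep => n; exact: scalerAl. Qed.
HB.instance Definition _ := GRing.Lmodule_isLalgebra.Build R[i] T scaleAl.
Let scaleAr (k : R[i]) x y : k *: (x * y) = x * (k *: y).
Proof. by apply: functional_extensionality_dep => n; exact: scalerAr. Qed.
HB.instance Definition _ := GRing.Lalgebra_isAlgebra.Build R[i] T scaleAr.

Definition bounded_seq : {pred T} :=
  fun x => `[< exists M : R, forall n, rnorm (x n) <= M >].

Let bounded_closed : GRing.subalg_closed bounded_seq.
Proof.
split=> [|k x y /asboolP[M xM] /asboolP[N yN]|x y /asboolP[M xM] /asboolP[N yN]].
- by apply/asboolP; exists 1 => n; rewrite rnorm1.
- apply/asboolP; exists (complex.Re `|k| * M + N) => n.
  apply: le_trans (rnormD _ _) _; rewrite rnormZ lerD //.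
  by rewrite ler_wpM2l ?Re_norm_ge0.
- apply/asboolP; exists (M * N) => n.
  by apply: le_trans (rnormM _ _) _; rewrite ler_pM ?rnorm_ge0.
Qed.
HB.instance Definition _ :=
  GRing.isSubalgClosed.Build R[i] T bounded_seq bounded_closed.

End SeqProd.

Record linfty (R : realType) (A : nat -> unitalBanachAlgType R[i]) :=
  Linfty { linfty_seq : seqprod A ; linfty_bounded : linfty_seq \in @bounded_seq R A }.

Section LInfty.
Context (R : realType) (A : nat -> unitalBanachAlgType R[i]).
Local Notation T := (linfty A).
Implicit Types x y : T.

HB.instance Definition _ := [isSub for @linfty_seq R A].
HB.instance Definition _ := [Choice of T by <:].
HB.instance Definition _ := [SubChoice_isSubAlgebra of T by <:].

Definition sup_norm x : R := sup (range (fun n => rnorm (linfty_seq x n))).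

Lemma sup_norm_ub x n : rnorm (linfty_seq x n) <= sup_norm x.
Proof.
apply: ub_le_sup; last by exists n.
by have /asboolP[M xM] := linfty_bounded x; exists M => _ [m _ <-].
Qed.

Lemma sup_norm_le x (M : R) :
  (forall n, rnorm (linfty_seq x n) <= M) -> sup_norm x <= M.
Proof.
by move=> xM; apply: ge_sup => [|_ [n _ <-]//]; exists (rnorm (linfty_seq x 0)), 0.
Qed.

Lemma sup_norm_ge0 x : 0 <= sup_norm x.
Proof. exact: le_trans (rnorm_ge0 _) (sup_norm_ub x 0). Qed.

Lemma sup_normD x y : sup_norm (x + y) <= sup_norm x + sup_norm y.
Proof.
apply: sup_norm_le => n; apply: le_trans (rnormD _ _) _.
by rewrite lerD ?sup_norm_ub.
Qed.

Lemma sup_normZ_le (k : R[i]) x : sup_norm (k *: x) <= complex.Re `|k| * sup_norm x.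
Proof.
apply: sup_norm_le => n.
by rewrite [X in X <= _]rnormZ ler_wpM2l ?sup_norm_ub ?Re_norm_ge0.
Qed.

Lemma sup_normZ (k : R[i]) x : sup_norm (k *: x) = complex.Re `|k| * sup_norm x.
Proof.
apply/eqP; rewrite eq_le sup_normZ_le andTb.
have [->|k0] := eqVneq k 0; first by rewrite normr0 mul0r sup_norm_ge0.
have Rk0 : 0 < complex.Re `|k| by rewrite -(@ltcR R) -normcE normr_gt0.
rewrite mulrC -ler_pdivlMr // mulrC -[in leLHS](scalerK k0 x).
apply: le_trans (sup_normZ_le _ _) _; rewrite ler_wpM2r ?sup_norm_ge0 //.
by rewrite -(@lecR R) -normcE normfV normcE -fmorphV.
Qed.

Let norm x : R[i] := (sup_norm x)%:C.
Let normD x y : norm (x + y) <= norm x + norm y.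
Proof. by rewrite -rmorphD lecR sup_normD. Qed.
Let normZ (k : R[i]) x : norm (k *: x) = `|k| * norm x.
Proof. by rewrite /norm sup_normZ rmorphM /= -normcE. Qed.
Let norm_eq0 x : norm x = 0 -> x = 0.
Proof.
move=> /(@complexI R) x0; apply: val_inj; apply: functional_extensionality_dep => n.
by apply: rnorm_eq0; apply/le_anti; rewrite rnorm_ge0 -x0 sup_norm_ub.
Qed.
HB.instance Definition _ := Lmodule_isNormed.Build R[i] T normD normZ norm_eq0.

Lemma rnorm_linftyE x :
  rnorm x = sup (range (fun n => rnorm (linfty_seq x n))).
Proof. by []. Qed.

Definition c0 : {pred T} :=
  fun x => `[< (fun n => rnorm (linfty_seq x n)) @ \oo --> (0 : R) >].

Lemma c0P x : reflect
  (forall e : R, 0 < e -> exists N, forall n, (N <= n)%N -> rnorm (linfty_seq x n) < e)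
  (x \in c0).
Proof.
apply: (iffP (asboolP _)) => [/cvgrPdist_lt x0 e e0|x0].
  have [N _ xN] := x0 _ e0; exists N => n Nn.
  by have := xN n Nn; rewrite /= sub0r normrN ger0_norm ?rnorm_ge0.
apply/cvgrPdist_lt => e e0; have [N xN] := x0 _ e0; exists N => // n Nn /=.
by rewrite sub0r normrN ger0_norm ?rnorm_ge0 ?xN.
Qed.

Lemma c0_closed : submod_closed c0.
Proof.
split=> [|k x y /c0P x0 /c0P y0].
  by apply/c0P => e e0; exists 0%N => n _; rewrite [X in X < _]rnorm0.
apply/c0P => e e0.
have k1 : 0 < complex.Re `|k| + 1 by rewrite ltr_pwDr ?Re_norm_ge0.
have e2 : 0 < e / 2 by rewrite divr_gt0.
have [|M xM] := x0 (e / 2 / (complex.Re `|k| + 1)); first by rewrite divr_gt0.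
have [N yN] := y0 _ e2; exists (maxn M N) => n; rewrite geq_max => /andP[Mn Nn].
apply: le_lt_trans (rnormD _ _) _; rewrite [e]splitr ltr_leD ?ltW ?yN //.
rewrite rnormZ; apply: le_lt_trans (_ : _ <= (complex.Re `|k| + 1) * rnorm (linfty_seq x n)) _.
  by rewrite ler_wpM2r ?rnorm_ge0 // lerDl.
by rewrite mulrC -ltr_pdivlMr // xM.
Qed.
HB.instance Definition _ := GRing.isSubmodClosed.Build R[i] T c0 c0_closed.

Lemma c0Ml x y : y \in c0 -> x * y \in c0.
Proof.
move=> /c0P y0; apply/c0P => e e0.
have k1 : 0 < sup_norm x + 1 by rewrite ltr_pwDr ?sup_norm_ge0.
have [|N yN] := y0 (e / (sup_norm x + 1)); first by rewrite divr_gt0.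
exists N => n Nn; apply: le_lt_trans (rnormM _ _) _.
apply: le_lt_trans (_ : _ <= (sup_norm x + 1) * rnorm (linfty_seq y n)) _.
  by rewrite ler_wpM2r ?rnorm_ge0 // (le_trans (sup_norm_ub x n)) // lerDl.
by rewrite mulrC -ltr_pdivlMr // yN.
Qed.

Lemma c0Mr x y : x \in c0 -> x * y \in c0.
Proof.
move=> /c0P x0; apply/c0P => e e0.
have k1 : 0 < sup_norm y + 1 by rewrite ltr_pwDr ?sup_norm_ge0.
have [|N xN] := x0 (e / (sup_norm y + 1)); first by rewrite divr_gt0.
exists N => n Nn; apply: le_lt_trans (rnormM _ _) _.
apply: le_lt_trans (_ : _ <= rnorm (linfty_seq x n) * (sup_norm y + 1)) _.
  by rewrite ler_wpM2l ?rnorm_ge0 // (le_trans (sup_norm_ub y n)) // lerDl.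
by rewrite -ltr_pdivlMr // xN.
Qed.

Lemma c0_one : (1 : T) \notin c0.
Proof.
apply/negP => /c0P /(_ 1 ltr01)[N /(_ N (leqnn N))].
by rewrite [X in X < _]rnorm1 ltxx.
Qed.

(* c_0 is closed for the supremum norm. *)
Lemma c0_approx x :
  (forall e : R, 0 < e -> exists2 y, y \in c0 & sup_norm (x - y) < e) -> x \in c0.
Proof.
move=> H; apply/c0P => e e0; have e2 : 0 < e / 2 by rewrite divr_gt0.
have [y /c0P y0 xy] := H _ e2; have [N yN] := y0 _ e2; exists N => n Nn.
rewrite -(subrK (linfty_seq y n) (linfty_seq x n)).
apply: le_lt_trans (rnormD _ _) _; rewrite [e]splitr ltrD ?yN //.
exact: le_lt_trans (sup_norm_ub (x - y) n) xy.
Qed.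

End LInfty.

(* The library only provides the additive quotient {ideal_quot I} here (its ring
   structure is restricted to commutative rings); the algebra structure and the
   quotient norm are installed below. *)
Definition Asy (R : realType) (A : nat -> unitalBanachAlgType R[i]) : Type :=
  {ideal_quot (@c0 R A)}.

Section Asymptotic.
Context (R : realType) (A : nat -> unitalBanachAlgType R[i]).
Local Notation L := (linfty A).
Local Notation Q := (Asy A).
Local Open Scope quotient_scope.

HB.instance Definition _ := GRing.Zmodule.on Q.
HB.instance Definition _ := EqQuotient.on Q.

Definition asy_pi (x : L) : Q := \pi_Q x.

Lemma asy_piP (x y : L) : reflect (asy_pi x = asy_pi y) (x - y \in @c0 R A).
Proof. by rewrite Quotient.idealrBE; exact: eqP. Qed.

Lemma asy_pi_surj (a : Q) : exists x, asy_pi x = a.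
Proof. by exists (repr a); rewrite /asy_pi reprK. Qed.

Lemma asy_piD (x y : L) : asy_pi (x + y) = asy_pi x + asy_pi y.
Proof. exact: Quotient.pi_add. Qed.

Lemma asy_pi0 : asy_pi 0 = 0.
Proof. by apply: (addrI (asy_pi 0)); rewrite -asy_piD !addr0. Qed.

Let mul (a b : Q) : Q := asy_pi (repr a * repr b).
Let one : Q := asy_pi 1.
Let scale (k : R[i]) (a : Q) : Q := asy_pi (k *: repr a).

Let repr_c0 (x : L) : repr (asy_pi x) - x \in @c0 R A.
Proof. by apply/asy_piP; rewrite /asy_pi reprK. Qed.

Let mulE (x y : L) : mul (asy_pi x) (asy_pi y) = asy_pi (x * y).
Proof.
apply/asy_piP.
rewrite -[X in X - _](subrK (x * repr (asy_pi y))) -mulrBl -addrA -mulrBr.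
by apply: rpredD; [exact/c0Mr/repr_c0|exact/c0Ml/repr_c0].
Qed.

Let scaleE (k : R[i]) (x : L) : scale k (asy_pi x) = asy_pi (k *: x).
Proof. by apply/asy_piP; rewrite -scalerBr rpredZ ?repr_c0. Qed.

Let mulA : associative mul.
Proof.
move=> a b c.
have [[[x <-] [y <-]] [z <-]] := (asy_pi_surj a, asy_pi_surj b, asy_pi_surj c).
by rewrite !mulE mulrA.
Qed.
Let mul1l : left_id one mul.
Proof. by move=> a; have [x <-] := asy_pi_surj a; rewrite mulE mul1r. Qed.
Let mul1r' : right_id one mul.
Proof. by move=> a; have [x <-] := asy_pi_surj a; rewrite mulE mulr1. Qed.
Let mulDl : left_distributive mul +%R.
Proof.
move=> a b c.
have [[[x <-] [y <-]] [z <-]] := (asy_pi_surj a, asy_pi_surj b, asy_pi_surj c).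
by rewrite -asy_piD !mulE mulrDl asy_piD.
Qed.
Let mulDr : right_distributive mul +%R.
Proof.
move=> a b c.
have [[[x <-] [y <-]] [z <-]] := (asy_pi_surj a, asy_pi_surj b, asy_pi_surj c).
by rewrite -asy_piD !mulE mulrDr asy_piD.
Qed.
Let one_neq0 : one != 0.
Proof.
by apply/eqP; rewrite -asy_pi0 => /asy_piP; rewrite subr0 (negbTE (c0_one A)).
Qed.
HB.instance Definition _ := GRing.Zmodule_isNzRing.Build Q
  mulA mul1l mul1r' mulDl mulDr one_neq0.

Let scaleA k l (a : Q) : scale k (scale l a) = scale (k * l) a.
Proof. by have [x <-] := asy_pi_surj a; rewrite !scaleE scalerA. Qed.
Let scale1 : left_id 1 scale.
Proof. by move=> a; have [x <-] := asy_pi_surj a; rewrite scaleE scale1r. Qed.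
Let scaleDr : right_distributive scale +%R.
Proof.
move=> k a b; have [[x <-] [y <-]] := (asy_pi_surj a, asy_pi_surj b).
by rewrite -asy_piD !scaleE scalerDr asy_piD.
Qed.
Let scaleDl (a : Q) : {morph scale^~ a : k l / k + l}.
Proof.
by move=> k l; have [x <-] := asy_pi_surj a; rewrite !scaleE scalerDl asy_piD.
Qed.
HB.instance Definition _ := GRing.Zmodule_isLmodule.Build R[i] Q
  scaleA scale1 scaleDr scaleDl.

Lemma asy_piM (x y : L) : asy_pi (x * y) = asy_pi x * asy_pi y.
Proof. by rewrite -mulE. Qed.
Lemma asy_piZ (k : R[i]) (x : L) : asy_pi (k *: x) = k *: asy_pi x.
Proof. by rewrite -scaleE. Qed.
Lemma asy_pi1 : asy_pi 1 = 1.
Proof. by []. Qed.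

Let scaleAl (k : R[i]) (a b : Q) : k *: (a * b) = (k *: a) * b.
Proof.
have [[x <-] [y <-]] := (asy_pi_surj a, asy_pi_surj b).
by rewrite -asy_piZ -!asy_piM -asy_piZ scalerAl.
Qed.
HB.instance Definition _ := GRing.Lmodule_isLalgebra.Build R[i] Q scaleAl.
Let scaleAr (k : R[i]) (a b : Q) : k *: (a * b) = a * (k *: b).
Proof.
have [[x <-] [y <-]] := (asy_pi_surj a, asy_pi_surj b).
by rewrite -asy_piZ -!asy_piM -asy_piZ scalerAr.
Qed.
HB.instance Definition _ := GRing.Lalgebra_isAlgebra.Build R[i] Q scaleAr.

Definition quot_norm (a : Q) : R :=
  inf [set rnorm x | x in [set x : L | asy_pi x = a]].

Let has_inf_quot (a : Q) : has_inf [set rnorm x | x in [set x : L | asy_pi x = a]].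
Proof.
split; first by have [x xa] := asy_pi_surj a; exists (rnorm x), x.
by exists 0 => _ [x _ <-]; exact: rnorm_ge0.
Qed.

Lemma quot_norm_le (x : L) : quot_norm (asy_pi x) <= rnorm x.
Proof. by apply: ge_inf; [case: (has_inf_quot (asy_pi x))|exists x]. Qed.

Lemma quot_norm_ge0 (a : Q) : 0 <= quot_norm a.
Proof.
by apply: lb_le_inf => [|_ [x _ <-]]; [case: (has_inf_quot a)|exact: rnorm_ge0].
Qed.

Lemma quot_norm_adh (a : Q) (e : R) : 0 < e ->
  exists2 x, asy_pi x = a & rnorm x < quot_norm a + e.
Proof.
by move=> e0; have [_ [x xa <-] xe] := inf_adherent e0 (has_inf_quot a); exists x.
Qed.

Lemma quot_normD (a b : Q) : quot_norm (a + b) <= quot_norm a + quot_norm b.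
Proof.
apply/ler_addgt0Pr => e e0; have e2 : 0 < e / 2 by rewrite divr_gt0.
have [x <- xe] := quot_norm_adh a e2; have [y <- ye] := quot_norm_adh b e2.
rewrite -asy_piD; apply: le_trans (quot_norm_le _) _.
apply: le_trans (rnormD _ _) _; rewrite [e]splitr addrACA.
by rewrite lerD ?ltW.
Qed.

Lemma quot_normZ_le (k : R[i]) (a : Q) :
  quot_norm (k *: a) <= complex.Re `|k| * quot_norm a.
Proof.
apply/ler_addgt0Pr => e e0.
have k1 : 0 < complex.Re `|k| + 1 by rewrite ltr_pwDr ?Re_norm_ge0.
have [|x <- xe] := @quot_norm_adh a (e / (complex.Re `|k| + 1)).
  by rewrite divr_gt0.
rewrite -asy_piZ; apply: le_trans (quot_norm_le _) _; rewrite rnormZ.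
apply: le_trans (ler_wpM2l (Re_norm_ge0 k) (ltW xe)) _.
rewrite mulrDr lerD2l mulrCA ler_piMr ?(ltW e0) //.
by rewrite ler_pdivrMr // mul1r lerDl.
Qed.

Lemma quot_normZ (k : R[i]) (a : Q) :
  quot_norm (k *: a) = complex.Re `|k| * quot_norm a.
Proof.
apply/eqP; rewrite eq_le quot_normZ_le andTb.
have [->|k0] := eqVneq k 0; first by rewrite normr0 mul0r quot_norm_ge0.
have Rk0 : 0 < complex.Re `|k| by rewrite -(@ltcR R) -normcE normr_gt0.
rewrite mulrC -ler_pdivlMr // mulrC -[in leLHS](scalerK k0 a).
apply: le_trans (quot_normZ_le _ _) _; rewrite ler_wpM2r ?quot_norm_ge0 //.
by rewrite -(@lecR R) -normcE normfV normcE -fmorphV.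
Qed.

Let norm (a : Q) : R[i] := (quot_norm a)%:C.
Let normD (a b : Q) : norm (a + b) <= norm a + norm b.
Proof. by rewrite -rmorphD lecR quot_normD. Qed.
Let normZ (k : R[i]) (a : Q) : norm (k *: a) = `|k| * norm a.
Proof. by rewrite /norm quot_normZ rmorphM /= -normcE. Qed.
Let norm_eq0 (a : Q) : norm a = 0 -> a = 0.
Proof.
move=> /(@complexI R); have [x <-] := asy_pi_surj a => x0.
rewrite -asy_pi0; apply/asy_piP; rewrite subr0; apply: c0_approx => e e0.
have [y yx ye] := quot_norm_adh (asy_pi x) e0; exists (x - y); first by apply/asy_piP.
by rewrite opprB addrC subrK; move: ye; rewrite x0 add0r.
Qed.
HB.instance Definition _ := Lmodule_isNormed.Build R[i] Q normD normZ norm_eq0.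

Lemma rnorm_asyE (a : Q) :
  rnorm a = inf [set rnorm x | x in [set x : L | asy_pi x = a]].
Proof. by []. Qed.

End Asymptotic.

Definition bounded_map (R : realType) (V W : normedModType R[i]) (f : V -> W) :=
  exists M : R, forall x, rnorm (f x) <= M * rnorm x.

Definition contractive_map (R : realType) (V W : normedModType R[i]) (f : V -> W) :=
  forall x, rnorm (f x) <= rnorm x.

Definition op_norm (R : realType) (V W : normedModType R[i]) (f : V -> W) : \bar R :=
  ereal_sup [set (rnorm (f x))%:E | x in [set x | rnorm x <= 1]].

(* conn h, for h : i <= j, is the connecting map from the i-th to the j-th
   algebra.  The upper limits over j >= i are taken along j = i + k. *)
Record inductive_system (R : realType) := InductiveSystem {
  alg :> nat -> unitalBanachAlgType R[i] ;
  conn : forall i j, (i <= j)%N -> {lrmorphism alg i -> alg j} ;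
  conn_bounded : forall i j (h : (i <= j)%N), bounded_map (conn h) ;
  conn_id : forall i (h : (i <= i)%N) a, conn h a = a ;
  conn_comp : forall i j k (hij : (i <= j)%N) (hjk : (j <= k)%N) a,
    conn hjk (conn hij a) = conn (leq_trans hij hjk) a ;
  conn_limsup : forall i,
    (limn_esup (fun k => op_norm (conn (leq_addr k i))) < +oo)%E
}.

(* The families quantified over in the universal property; the canonical maps
   into the limit form one themselves. *)
Record compatible_family (R : realType) (S : inductive_system R)
    (B : unitalBanachAlgType R[i]) (psi : forall i, {lrmorphism S i -> B}) : Prop := {
  compatible_bounded : forall i, bounded_map (psi i) ;
  compatible_conn : forall i j (h : (i <= j)%N) a, psi i a = psi j (conn S h a) ;
  compatible_norm : forall i a,
    ((rnorm (psi i a))%:E <=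
       limn_esup (fun k => (rnorm (conn S (leq_addr k i) a))%:E))%E
}.

Definition is_inductive_limit (R : realType) (S : inductive_system R)
    (L : unitalBanachAlgType R[i]) (phi : forall i, {lrmorphism S i -> L}) : Prop :=
  compatible_family phi /\
  forall (B : unitalBanachAlgType R[i]) (psi : forall i, {lrmorphism S i -> B}),
    compatible_family psi ->
    exists f : {lrmorphism L -> B},
      [/\ contractive_map f, forall i a, f (phi i a) = psi i a
        & forall g : {lrmorphism L -> B}, contractive_map g ->
            (forall i a, g (phi i a) = psi i a) -> g =1 f].

(* Main.v *)
(* Sending [a : S i] to the class of the sequence that is [0] before the index [i] and
   [conn a] from [i] on defines a compatible family into [Asy S], since the quotient norm
   of a class is the upper limit of the norms of the terms of any representative.  As
   [Asy S] is complete, the universal property yields a contraction [theta], and [theta]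
   does not decrease the norm of [phi i a], which is at most that upper limit.  It remains
   to see that the elements [phi i a] are dense: their closure is itself a unital Banach
   algebra, so the universal property gives a map from [L] into it, and by uniqueness
   this map followed by the inclusion is the identity of [L]. *)
Require Import Defs.
From HB Require Import structures.
From mathcomp Require Import all_boot all_order all_algebra.
From mathcomp Require Import ring complex boolp classical_sets reals ereal topology.
From mathcomp Require Import normedtype sequences.
Import Order.TTheory GRing.Theory Num.Theory.
Import numFieldNormedType.Exports.

Set Implicit Arguments.
Unset Strict Implicit.
Unset Printing Implicit Defensive.

Local Open Scope classical_set_scope.
Local Open Scope complex_scope.
Local Open Scope ring_scope.

(** * Completeness tested on rapidly Cauchy sequences *)

Section Completeness.
Context (R : realType) (V : normedModType R[i]).

Lemma ball_rnormE (x y : V) (e : R) : ball x e%:C y <-> rnorm (x - y) < e.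
Proof. by rewrite -ball_normE /ball_ /= rnormE ltcR. Qed.

(** Centres [u k] of balls of radius [2 ^- k.+1] that belong to [F] satisfy the hypothesis, because
    any two of these balls meet. A limit of [u] is then a limit of [F], as the radii tend to 0. *)
Lemma complete_fast_cauchy :
  (forall u : nat -> V,
     (forall m n, (m <= n)%N -> rnorm (u n - u m) <= 2 ^- m) ->
     exists l, forall e : R, 0 < e -> \forall n \near \oo, rnorm (u n - l) < e) ->
  forall F : set_system V, ProperFilter F -> cauchy F -> cvg F.
Proof.
move=> complV F FF /cauchyP cF.
have p2 n : 0 < 2 ^- n :> R by rewrite invr_gt0 exprn_gt0.
have /choice[u uF] : forall k, exists x : V, F (ball x (2 ^- k.+1)%:C).
  by move=> k; apply: cF; rewrite ltcR.
have [m n mn|l ul] := complV u.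
  have [x [/ball_rnormE xn /ball_rnormE xm]] := filter_ex (filterI (uF n) (uF m)).
  rewrite -(subrKA x) -[x - u m]opprB.
  apply: le_trans (rnormD _ _) _; rewrite rnormN.
  apply: le_trans (lerD (ltW xn) (ltW xm)) _.
  rewrite [leRHS]splitr lerD // exprS invfM mulrC ler_pM2r ?invr_gt0 //.
  by rewrite lef_pV2 ?posrE ?exprn_gt0 // ler_weXn2l // ler1n.
apply/cvg_ex; exists l; apply/cvg_ballP => e e0.
have eE : e = (complex.Re e)%:C by rewrite RRe_real // gtr0_real.
have e0' : 0 < complex.Re e by rewrite -ltcR -eE.
have e2 : 0 < complex.Re e / 2 by rewrite divr_gt0.
have small : \forall n \near \oo, 2 ^- n.+1 < complex.Re e / 2 :> R.
  have [N _ HN] := near_infty_natSinv_expn_lt (PosNum e2).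
  exists N => // n Nn; have := HN n Nn; rewrite /= div1r; apply: le_lt_trans.
  by rewrite lef_pV2 ?posrE ?exprn_gt0 // ler_weXn2l // ler1n.
have [n [un sn]] := filter_ex (filterI (ul _ e2) small).
apply: filterS (uF n) => x /ball_rnormE xn; rewrite eE; apply/ball_rnormE.
rewrite -(subrKA (u n)) [complex.Re e]splitr.
apply: le_lt_trans (rnormD _ _) _; rewrite -opprB rnormN ltrD //.
exact: lt_trans xn sn.
Qed.

End Completeness.

(** * [Asy A] as a unital Banach algebra *)

Section AsyComplete.
Context (R : realType) (A : nat -> unitalBanachAlgType R[i]).
Implicit Types x y : linfty A.

(** Replacing the terms before [N] by 0 does not change the class, and leaves a representative of
    supremum norm at most [c]. *)
Lemma quot_norm_le_tail x N (c : R) :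
  (forall n, (N <= n)%N -> rnorm (linfty_seq x n) <= c) ->
  quot_norm (asy_pi x) <= c.
Proof.
move=> xc; have c_ge0 : 0 <= c by exact: le_trans (rnorm_ge0 _) (xc N (leqnn N)).
pose t : Defs.seqprod A := fun n => if (N <= n)%N then linfty_seq x n else 0.
have tc n : rnorm (t n) <= c.
  by rewrite /t; case: ifP => [/xc//|_]; rewrite rnorm0.
have tb : t \in @bounded_seq R A by apply/asboolP; exists c.
rewrite (_ : asy_pi x = asy_pi (Linfty tb)); last first.
  apply/asy_piP/c0P => e e0; exists N => n Nn.
  have -> : linfty_seq (x - Linfty tb) n = linfty_seq x n - t n by [].
  by rewrite /t Nn subrr rnorm0.
by apply: le_trans (quot_norm_le _) _; exact: sup_norm_le.
Qed.

(** Half of the gap below [c] is spent on a nearly optimal representative [y], the other half on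
    [x - y], which tends to 0. With [quot_norm_le_tail], this identifies the quotient norm with an
    upper limit. *)
Lemma quot_norm_lt_tail x (c : R) : quot_norm (asy_pi x) < c ->
  \forall n \near \oo, rnorm (linfty_seq x n) < c.
Proof.
move=> xc; pose e := (c - quot_norm (asy_pi x)) / 2.
have e0 : 0 < e by rewrite divr_gt0 // subr_gt0.
have [y /esym/asy_piP/c0P/(_ _ e0)[N xyN] ye] := quot_norm_adh (asy_pi x) e0.
exists N => // n Nn /=.
have -> : c = e + (quot_norm (asy_pi x) + e).
  by rewrite addrCA -splitr addrC subrK.
rewrite -(subrK (linfty_seq y n) (linfty_seq x n)).
apply: le_lt_trans (rnormD _ _) _; rewrite ltrD ?xyN //.
exact: le_lt_trans (sup_norm_ub y n) ye.
Qed.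

Lemma asy_piB x y : asy_pi (x - y) = asy_pi x - asy_pi y.
Proof. by apply: (addIr (asy_pi y)); rewrite -asy_piD !subrK. Qed.

Lemma quot_normM (a b : Asy A) : quot_norm (a * b) <= quot_norm a * quot_norm b.
Proof.
apply/ler_addgt0Pr => e e0; set p := quot_norm a; set q := quot_norm b.
have p0 : 0 <= p := quot_norm_ge0 a; have q0 : 0 <= q := quot_norm_ge0 b.
have r0 : 0 < p + q + 1 by rewrite ltr_wpDl ?addr_ge0.
(* Since [d <= 1] and [d * (p + q + 1) <= e], the product [(p + d) * (q + d)] exceeds [p * q] by at
   most [e]. *)
pose d := Num.min 1 (e / (p + q + 1)).
have d0 : 0 < d by rewrite lt_min ltr01 divr_gt0.
have [x xa xd] := quot_norm_adh a d0; have [y yb yd] := quot_norm_adh b d0.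
rewrite -xa -yb -asy_piM; apply: le_trans (quot_norm_le _) _.
apply: (@le_trans _ _ ((p + d) * (q + d))).
  apply: sup_norm_le => n; apply: le_trans (rnormM _ _) _.
  by rewrite ler_pM ?rnorm_ge0 // (le_trans (sup_norm_ub _ n)) // ltW.
rewrite [leLHS](_ : _ = p * q + d * (p + q + d)); last by ring.
rewrite lerD2l -(@ler_pM2r _ (p + q + 1)^-1) ?invr_gt0 //.
apply: le_trans (_ : d * 1 <= _); last by rewrite mulr1 ge_min lexx orbT.
rewrite -mulrA ler_pM2l // ler_pdivrMr // mul1r lerD2l.
by rewrite ge_min lexx.
Qed.

Lemma quot_norm1 : quot_norm (1 : Asy A) = 1.
Proof.
apply/eqP; rewrite eq_le -asy_pi1; apply/andP; split.
  by apply: (@quot_norm_le_tail _ 0) => n _; rewrite [leLHS]rnorm1.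
rewrite leNgt; apply/negP => /quot_norm_lt_tail[N _ /(_ N (leqnn N))] /=.
by rewrite [X in X < _]rnorm1 ltxx.
Qed.

(* Diagonal argument: [s] is at the index [p] the [p]-th term of the representative
   [x k], for the largest [k <= p] such that [x k] is, at [p], as close to all the
   earlier representatives as their classes require. *)
Lemma asy_complete (F : set_system (Asy A)) :
  ProperFilter F -> cauchy F -> cvg F.
Proof.
apply: complete_fast_cauchy => u u_cauchy.
have /choice[x xu] k : exists x, asy_pi x = u k by exact: asy_pi_surj.
have p2 n : 0 < 2 ^- n :> R by rewrite invr_gt0 exprn_gt0.
pose close k p := [forall m : 'I_k.+1,
  rnorm (linfty_seq (x k) p - linfty_seq (x m) p) <= 2 * 2 ^- m].
have closeP k p m : close k p -> (m <= k)%N ->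
    rnorm (linfty_seq (x k) p - linfty_seq (x m) p) <= 2 * 2 ^- m.
  by rewrite -ltnS => /forallP/[swap] mk /(_ (Ordinal mk)).
have close_near k : \forall p \near \oo, close k p.
  suff : \forall p \near \oo, forall m : 'I_k.+1,
      rnorm (linfty_seq (x k) p - linfty_seq (x m) p) <= 2 * 2 ^- m.
    by apply: filterS => p /forallP.
  apply: filter_forall => m.
  (* The factor 2 makes the bound on the class strict, so that it passes to almost all terms. *)
  have /quot_norm_lt_tail : quot_norm (asy_pi (x k - x m)) < 2 * 2 ^- m.
    rewrite asy_piB !xu mulr_natl mulr2n ltr_pwDl //.
    by apply: u_cauchy; rewrite -ltnS.
  by apply: filterS => p /ltW.
have /choice[k kP] p : exists k, close k p /\
    forall j, (j <= p)%N -> close j p -> (j <= k)%N.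
  (* The index 0 always qualifies, being compared only with itself. *)
  have ex0 : exists k, (k <= p)%N && close k p.
    exists 0%N; rewrite leq0n; apply/forallP => m.
    by rewrite (ord1 m) subrr rnorm0 mulr_ge0 // ltW.
  have bd j : (j <= p)%N && close j p -> (j <= p)%N by case/andP.
  case: (ex_maxnP ex0 bd) => k /andP[kp kc] kmax; exists k; split=> // j jp jc.
  by apply: kmax; rewrite jp.
pose s : Defs.seqprod A := fun p => linfty_seq (x (k p)) p.
(* Once [j <= p] and [close j p], maximality gives [j <= k p], and [close (k p) p] then compares
   [s p] with [x j]. *)
have sP j : \forall p \near \oo, rnorm (s p - linfty_seq (x j) p) <= 2 * 2 ^- j.
  apply: filterS (filterI (close_near j) (nbhs_infty_ge j)) => p [jc jp]; have [kc kmax] := kP p.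
  by apply: closeP kc _; exact: kmax.
have sb : s \in @bounded_seq R A.
  apply/asboolP; exists (2 + sup_norm (x 0%N)) => p.
  rewrite -(subrK (linfty_seq (x 0%N) p) (s p)).
  apply: le_trans (rnormD _ _) _; rewrite lerD ?sup_norm_ub //.
  have [kc _] := kP p; have := closeP _ _ _ kc (leq0n _).
  by rewrite expr0 invr1 mulr1.
exists (asy_pi (Linfty sb)) => e e0.
have e2 : 0 < e / 2 by rewrite divr_gt0.
apply: filterS (near_infty_natSinv_expn_lt (PosNum e2)) => j /=.
rewrite div1r ltr_pdivlMr // mulrC; apply: le_lt_trans.
have [N _ sN] := sP j; rewrite -xu -asy_piB.
apply: (@quot_norm_le_tail _ N) => p Np; rewrite -rnormN opprB; exact: sN.
Qed.

HB.instance Definition _ := Uniform_isComplete.Build (Asy A) asy_complete.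

End AsyComplete.

Section AsyBanach.
Context (R : realType) (A : nat -> unitalBanachAlgType R[i]).

Let normM (a b : Asy A) : `|a * b| <= `|a| * `|b|.
Proof. by rewrite !rnormE -rmorphM lecR; exact: quot_normM. Qed.
Let norm1 : `|1 : Asy A| = 1.
Proof. by rewrite rnormE [rnorm _]quot_norm1. Qed.
HB.instance Definition _ :=
  CompleteNormedModule_isUnitalBanachAlgebra.Build R[i] (Asy A)
    (@mulrA (Asy A)) (@mul1r (Asy A)) (@mulr1 (Asy A)) (@mulrDl (Asy A)) (@mulrDr (Asy A))
    (@scalerAl R[i] (Asy A)) (@scalerAr R[i] (Asy A)) normM norm1.

End AsyBanach.

(** * The closure of a subalgebra as a unital Banach algebra *)

Section Closure.
Context (R : realType) (A : unitalBanachAlgType R[i]).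

Definition adherent (Q : {pred A}) : {pred A} :=
  fun x => `[< forall e : R, 0 < e -> exists2 y, y \in Q & rnorm (x - y) < e >].

Lemma sub_adherent (Q : {pred A}) : {subset Q <= adherent Q}.
Proof. by move=> x Qx; apply/asboolP => e e0; exists x; rewrite // subrr rnorm0. Qed.

Lemma adherent_closed (Q : {pred A}) x :
  (forall e : R, 0 < e -> exists2 y, y \in adherent Q & rnorm (x - y) < e) ->
  x \in adherent Q.
Proof.
move=> H; apply/asboolP => e e0; have e2 : 0 < e / 2 by rewrite divr_gt0.
have [y /asboolP/(_ _ e2)[z Qz yz] xy] := H _ e2; exists z => //.
rewrite -(subrKA y) [e]splitr; apply: le_lt_trans (rnormD _ _) _.
by rewrite ltrD.
Qed.

Variable Q : subalgClosed A.

Lemma adherent_subalg : GRing.subalg_closed (adherent Q).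
Proof.
have [Q1 QZD QM] := GRing.subalgClosedP Q.
split=> [|k x y /asboolP Qx /asboolP Qy|x y /asboolP Qx /asboolP Qy].
- exact: sub_adherent.
- apply/asboolP => e e0; have e2 : 0 < e / 2 by rewrite divr_gt0.
  have k1 : 0 < complex.Re `|k| + 1 by rewrite ltr_pwDr ?Re_norm_ge0.
  (* Dividing by the modulus of [k] plus 1 covers [k = 0] as well. *)
  have [|x' Qx' xx'] := Qx (e / 2 / (complex.Re `|k| + 1)); first by rewrite divr_gt0.
  have [y' Qy' yy'] := Qy _ e2; exists (k *: x' + y'); first exact: QZD.
  rewrite opprD addrACA -scalerBr; apply: le_lt_trans (rnormD _ _) _.
  rewrite [e]splitr ler_ltD // rnormZ.
  apply: le_trans (_ : _ <= (complex.Re `|k| + 1) * rnorm (x - x')) _.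
    by rewrite ler_wpM2r ?rnorm_ge0 // lerDl.
  by rewrite mulrC -ler_pdivlMr // ltW.
- apply/asboolP => e e0; set p := rnorm x; set q := rnorm y.
  have p0 : 0 <= p := rnorm_ge0 x; have q0 : 0 <= q := rnorm_ge0 y.
  have r0 : 0 < p + q + 1 by rewrite ltr_wpDl ?addr_ge0.
  (* The bound [d <= 1] gives [rnorm y' <= q + 1], so the error of the product is less than
     [p * d + d * (q + 1)], which is at most [e]. *)
  pose d := Num.min 1 (e / (p + q + 1)).
  have d0 : 0 < d by rewrite lt_min ltr01 divr_gt0.
  have [x' Qx' xx'] := Qx _ d0; have [y' Qy' yy'] := Qy _ d0.
  exists (x' * y'); first exact: QM.
  have y'q : rnorm y' <= q + 1.
    rewrite -(subrK y y') addrC; apply: le_trans (rnormD _ _) _.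
    rewrite lerD2l -opprB rnormN ltW // (lt_le_trans yy') //.
    by rewrite ge_min lexx.
  have -> : x * y - x' * y' = x * (y - y') + (x - x') * y'.
    by rewrite mulrBr mulrBl subrKA.
  apply: le_lt_trans (rnormD _ _) _.
  apply: (@lt_le_trans _ _ (p * d + d * (q + 1))).
    apply: ler_ltD.
      by apply: le_trans (rnormM _ _) _; rewrite ler_wpM2l // ltW.
    apply: le_lt_trans (rnormM _ _) _.
    apply: le_lt_trans (ler_wpM2l (rnorm_ge0 _) y'q) _.
    by rewrite ltr_pM2r // ltr_wpDl.
  rewrite mulrC -mulrDr addrA -ler_pdivlMr //.
  by rewrite ge_min lexx orbT.
Qed.
HB.instance Definition _ :=
  GRing.isSubalgClosed.Build R[i] A (adherent Q) adherent_subalg.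

(** A type of its own, so that the closure can be a target in the universal property. *)
Record subalg_closure := SubalgClosure {
  closure_val : A ; closure_valP : closure_val \in adherent Q }.
Local Notation T := subalg_closure.

HB.instance Definition _ := [isSub for closure_val].
HB.instance Definition _ := [Choice of T by <:].
HB.instance Definition _ := [SubChoice_isSubAlgebra of T by <:].

Let norm (x : T) : R[i] := `|closure_val x|.
Let normD (x y : T) : norm (x + y) <= norm x + norm y.
Proof. exact: ler_normD. Qed.
Let normZ (k : R[i]) (x : T) : norm (k *: x) = `|k| * norm x.
Proof. exact: normrZ. Qed.
Let norm_eq0 (x : T) : norm x = 0 -> x = 0.
Proof. by move=> /normr0_eq0 x0; exact: val_inj. Qed.
HB.instance Definition _ := Lmodule_isNormed.Build R[i] T normD normZ norm_eq0.

Lemma subalg_closure_complete (F : set_system T) :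
  ProperFilter F -> cauchy F -> cvg F.
Proof.
apply: complete_fast_cauchy => u u_cauchy.
have : cauchy ((closure_val \o u) @ \oo).
  apply/cauchyP => e e0.
  have eE : e = (complex.Re e)%:C by rewrite RRe_real // gtr0_real.
  have e0' : 0 < complex.Re e by rewrite -ltcR -eE.
  have [N _ /(_ N (leqnn N)) /= HN] := near_infty_natSinv_expn_lt (PosNum e0').
  exists (closure_val (u N)); rewrite eE; exists N => // n /= Nn.
  apply/ball_rnormE; rewrite -rnormN opprB.
  by apply: le_lt_trans (u_cauchy _ _ Nn) _; rewrite -div1r.
move=> /cauchy_cvg/cvg_ex[l /cvg_ballP ul].
have ulr e : 0 < e -> \forall n \near \oo, rnorm (closure_val (u n) - l) < e.
  move=> e0; have := ul e%:C; rewrite ltcR => /(_ e0).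
  by apply: filterS => n /ball_rnormE; rewrite -rnormN opprB.
have lQ : l \in adherent Q.
  apply: adherent_closed => e e0; have [n un] := filter_ex (ulr e e0).
  by exists (closure_val (u n)); [exact: closure_valP|rewrite -rnormN opprB].
by exists (SubalgClosure lQ) => e /ulr.
Qed.
HB.instance Definition _ := Uniform_isComplete.Build T subalg_closure_complete.

Let normM (x y : T) : `|x * y| <= `|x| * `|y|.
Proof. exact: normrM_le. Qed.
Let norm1 : `|1 : T| = 1.
Proof. exact: normr_one. Qed.
HB.instance Definition _ :=
  CompleteNormedModule_isUnitalBanachAlgebra.Build R[i] T
    (@mulrA T) (@mul1r T) (@mulr1 T) (@mulrDl T) (@mulrDr T)
    (@scalerAl R[i] T) (@scalerAr R[i] T) normM norm1.

End Closure.

(** * Tail sequences and their classes in [Asy S] *)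

Section Tail.
Context (R : realType) (S : inductive_system R).

Lemma limn_esup_lt (u : nat -> \bar R) (c : \bar R) :
  (limn_esup u < c)%E -> \forall n \near \oo, (u n < c)%E.
Proof.
move=> /ereal_inf_lt[_ [V Voo <-] Vc]; apply: filterS (Voo) => n Vn.
by apply: le_lt_trans Vc; apply: ereal_sup_ubound; exists n.
Qed.

Lemma limn_esup_le (u : nat -> \bar R) (c : \bar R) :
  (\forall n \near \oo, (u n <= c)%E) -> (limn_esup u <= c)%E.
Proof.
move=> uc; apply: ge_ereal_inf; exists (ereal_sup (u @` [set n | (u n <= c)%E])).
  by exists [set n | (u n <= c)%E].
by apply: ge_ereal_sup => _ [n un <-].
Qed.

Lemma op_normP (V W : normedModType R[i]) (f : V -> W) (M : R) x : scalable f ->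
  (op_norm f <= M%:E)%E -> rnorm (f x) <= M * rnorm x.
Proof.
move=> fZ fM; have [->|x0] := eqVneq x 0.
  by rewrite -(scale0r 0) fZ !scale0r !rnorm0 mulr0.
have nx : 0 < rnorm x.
  by rewrite lt_neqAle rnorm_ge0 andbT eq_sym; apply: contraNneq x0 => /rnorm_eq0/eqP.
have Nx : complex.Re `|(rnorm x)%:C^-1| = (rnorm x)^-1.
  by rewrite -[_^-1]fmorphV ger0_norm ?lecR ?invr_ge0 ?rnorm_ge0.
rewrite -ler_pdivrMr // mulrC -Nx -rnormZ -fZ -lee_fin.
apply: le_trans fM; apply: ereal_sup_ubound; eexists; last by [].
by rewrite /= rnormZ Nx mulVf // gt_eqF.
Qed.

(** Matching on [idP] provides the proof of [i <= n] that [conn] takes as an argument. *)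
Definition tail_seq i (a : S i) : Defs.seqprod S := fun n =>
  if @idP (i <= n)%N is ReflectT h then conn S h a else 0.

Lemma tail_seqE i (a : S i) n (h : (i <= n)%N) : tail_seq a n = conn S h a.
Proof.
rewrite /tail_seq; case: {-}_ / idP => [h'|/(_ h)//].
by rewrite (bool_irrelevance h' h).
Qed.

(** A finite upper limit of the operator norms yields one [M] for almost all connecting maps. It is
    chosen before [a], and so also bounds the map [tail_class]. *)
Lemma tail_seq_le i : exists M : R, forall a : S i,
  \forall n \near \oo, rnorm (tail_seq a n) <= M * rnorm a.
Proof.
have [M [N HN]] : exists (M : R) N, forall k, (N <= k)%N ->
    (op_norm (conn S (leq_addr k i)) <= M%:E)%E.
  have := conn_limsup S i; set l := limn_esup _ => loo.
  have [M lM] : exists M : R, (l < M%:E)%E.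
    case: l loo => [r _|//|_]; last by exists 0; rewrite ltNyr.
    by exists (r + 1); rewrite lte_fin ltrDl.
  by have [N _ HN] := limn_esup_lt lM; exists M, N => k Nk; apply/ltW/HN.
exists M => a; exists (i + N)%N => // n /= iNn.
rewrite -(subnKC (leq_trans (leq_addr N i) iNn)) (tail_seqE _ (leq_addr _ _)).
apply: op_normP; first by move=> k x; rewrite linearZ.
by apply: HN; rewrite leq_subRL // (leq_trans (leq_addr N i)).
Qed.

Lemma tail_bounded i (a : S i) : tail_seq a \in @bounded_seq R S.
Proof.
have [M /(_ a)[N _ aM]] := tail_seq_le i; apply/asboolP.
(* The first summand bounds the terms from [N] on, the sum the finitely many earlier ones. *)
exists (M * rnorm a + \sum_(m < N) rnorm (tail_seq a m)) => n.
have [nN|/aM an] := ltnP n N; last first.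
  by rewrite (le_trans an) // lerDl sumr_ge0 // => m _; exact: rnorm_ge0.
have Ma : 0 <= M * rnorm a by exact: le_trans (rnorm_ge0 _) (aM N (leqnn N)).
rewrite (bigD1 (Ordinal nN)) //= addrCA lerDl addr_ge0 // sumr_ge0 // => m _.
exact: rnorm_ge0.
Qed.

Definition tail_class i (a : S i) : Asy S := asy_pi (Linfty (tail_bounded a)).

Lemma eq_asy_pi (x y : linfty S) N :
  (forall n, (N <= n)%N -> linfty_seq x n = linfty_seq y n) -> asy_pi x = asy_pi y.
Proof.
move=> xy; apply/asy_piP/c0P => e e0; exists N => n Nn.
have -> : linfty_seq (x - y) n = linfty_seq x n - linfty_seq y n by [].
by rewrite xy // subrr rnorm0.
Qed.

Lemma tail_class_linear i : linear (@tail_class i).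
Proof.
move=> k a b; rewrite /tail_class -asy_piZ -asy_piD; apply: (@eq_asy_pi _ _ i) => n h.
change (tail_seq (k *: a + b) n = k *: tail_seq a n + tail_seq b n).
by rewrite !tail_seqE linearP.
Qed.

(** The terms of [tail_seq 1] before [i] are 0 and not 1; the class does not see them. *)
Lemma tail_class_monoid i : monoid_morphism (@tail_class i).
Proof.
split=> [|a b].
  rewrite -asy_pi1; apply: (@eq_asy_pi _ _ i) => n h.
  by change (tail_seq (1 : S i) n = 1); rewrite tail_seqE rmorph1.
rewrite /tail_class -asy_piM; apply: (@eq_asy_pi _ _ i) => n h.
change (tail_seq (a * b) n = tail_seq a n * tail_seq b n).
by rewrite !tail_seqE rmorphM.
Qed.

HB.instance Definition _ i :=
  GRing.isLinear.Build R[i] (S i) (Asy S) *:%R (@tail_class i) (@tail_class_linear i).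
HB.instance Definition _ i :=
  GRing.isMonoidMorphism.Build (S i) (Asy S) (@tail_class i) (@tail_class_monoid i).

(** The upper limit is an infimum of suprema over neighbourhoods of infinity. Each supremum bounds a
    tail, hence the quotient norm; conversely, almost all terms lie below the quotient norm plus
    [e]. The [k]-th term here is the term [i + k] of [tail_seq a]. *)
Lemma tail_class_norm i (a : S i) : (rnorm (tail_class a))%:E =
  limn_esup (fun k => (rnorm (conn S (leq_addr k i) a))%:E).
Proof.
apply/eqP; rewrite eq_le; apply/andP; split.
  apply: le_ereal_inf_tmp => _ [V [N _ NV] <-].
  have Vle k : (N <= k)%N -> ((rnorm (tail_seq a (i + k)%N))%:E <=
      ereal_sup ((fun k => (rnorm (conn S (leq_addr k i) a))%:E) @` V))%E.
    move=> Nk; apply: ereal_sup_ubound.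
    by exists k; [exact: NV|rewrite (tail_seqE _ (leq_addr k i))].
  (* The supremum is not [-oo], since [V] contains [N]; for [+oo] the bound is trivial. *)
  case: (ereal_sup _) Vle => [r Vle|_|/(_ N (leqnn N))//]; last by rewrite leey.
  rewrite lee_fin; apply: (@quot_norm_le_tail _ _ _ (i + N)%N) => n iNn.
  have ni := leq_trans (leq_addr N i) iNn.
  have := Vle (n - i)%N; rewrite leq_subRL // lee_fin subnKC //; exact.
apply/lee_addgt0Pr => e e0; apply: limn_esup_le.
have [|N _ HN] := @quot_norm_lt_tail _ _ (Linfty (tail_bounded a))
   (rnorm (tail_class a) + e); first by rewrite ltrDl.
exists N => // k /= Nk; rewrite -EFinD lee_fin -tail_seqE ltW //.
by apply: HN => /=; exact: leq_trans Nk (leq_addl _ _).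
Qed.

Lemma tail_class_compatible : compatible_family
  (fun i => @tail_class i : {lrmorphism S i -> (Asy S : unitalBanachAlgType R[i])}).
Proof.
split=> [i|i j h a|i a]; last by rewrite -tail_class_norm.
  have [M HM] := tail_seq_le i; exists M => a; have [N _ aM] := HM a.
  by apply: (@quot_norm_le_tail _ _ _ N) => n; exact: aM.
apply: (@eq_asy_pi _ _ j) => n jn; change (tail_seq a n = tail_seq (conn S h a) n).
by rewrite (tail_seqE _ (leq_trans h jn)) (tail_seqE _ jn) conn_comp.
Qed.

End Tail.

(** * Density of the images in the inductive limit *)

Section Density.
Context (R : realType) (S : inductive_system R) (L : unitalBanachAlgType R[i]).
Variable phi : forall i, {lrmorphism S i -> L}.

Definition image_union : {pred L} := fun x => `[< exists i a, x = phi i a >].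

Hypothesis phi_comp : compatible_family phi.

Lemma image_union_subalg : GRing.subalg_closed image_union.
Proof.
(* The images increase with the index, so two elements can be moved to the larger of their
   indices. *)
have common x y : x \in image_union -> y \in image_union ->
    exists k (a b : S k), x = phi k a /\ y = phi k b.
  move=> /asboolP[i [a ->]] /asboolP[j [b ->]]; exists (maxn i j).
  exists (conn S (leq_maxl i j) a), (conn S (leq_maxr i j) b).
  by split; exact: (compatible_conn phi_comp).
split=> [|k x y /common/[apply]|x y /common/[apply]].
- by apply/asboolP; exists 0%N, 1; rewrite rmorph1.
- by case=> n [a [b [-> ->]]]; apply/asboolP; exists n, (k *: a + b); rewrite linearP.
- by case=> n [a [b [-> ->]]]; apply/asboolP; exists n, (a * b); rewrite rmorphM.
Qed.

End Density.

Lemma images_dense (R : realType) (S : inductive_system R)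
    (L : unitalBanachAlgType R[i]) (phi : forall i, {lrmorphism S i -> L}) :
  is_inductive_limit phi -> forall x, x \in adherent (image_union phi).
Proof.
move=> [phi_comp univ] x.
(* The union is a subalgebra by virtue of [phi_comp], so its structure is packed locally. *)
pose subalgM := GRing.isSubalgClosed.Build R[i] L (image_union phi)
  (image_union_subalg phi_comp).
pose Q : subalgClosed L := HB.pack (image_union phi) subalgM.
pose B : unitalBanachAlgType R[i] := subalg_closure Q.
have phiQ i a : phi i a \in adherent Q.
  by apply: sub_adherent; apply/asboolP; exists i, a.
pose io i a : B := SubalgClosure (phiQ i a).
have io_linear i : linear (io i).
  by move=> k a b; apply: val_inj; rewrite /= linearP.
have io_monoid i : monoid_morphism (io i).
  by split=> [|a b]; apply: val_inj; rewrite /= ?rmorph1 ?rmorphM.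
pose ioL i := GRing.isLinear.Build R[i] (S i) B *:%R (io i) (io_linear i).
pose ioM i := GRing.isMonoidMorphism.Build (S i) B (io i) (io_monoid i).
pose iota i : {lrmorphism S i -> B} := HB.pack (io i) (ioL i) (ioM i).
have iota_comp : compatible_family iota.
  split=> [i|i j h a|i a]; last exact: (compatible_norm phi_comp).
    exact: (compatible_bounded phi_comp).
  by apply: val_inj; exact: (compatible_conn phi_comp).
have [f [f_contr fphi _]] := univ _ _ iota_comp.
(* With [phi] itself as the target family, the identity and [f] followed by the inclusion both equal
   [h]. *)
have [h [_ _ h_uniq]] := univ _ _ phi_comp.
have id_h := h_uniq idfun (fun=> lexx _) (fun _ _ => erefl).
pose g y := closure_val (f y).
have g_linear : linear g by move=> k y z; rewrite /g linearP.
have g_monoid : monoid_morphism g.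
  by split=> [|y z]; rewrite /g ?rmorph1 ?rmorphM.
pose gL := GRing.isLinear.Build R[i] L L *:%R g g_linear.
pose gM := GRing.isMonoidMorphism.Build L L g g_monoid.
pose gLR : {lrmorphism L -> L} := HB.pack g gL gM.
have g_h : gLR =1 h.
  by apply: h_uniq => [y|i a]; [exact: f_contr|rewrite /= /g fphi].
have -> : x = closure_val (f x) by rewrite [LHS]id_h -g_h.
exact: closure_valP.
Qed.

(** * Isometry of the induced map *)

Theorem proposition4p4 (R : realType) (S : inductive_system R)
    (L : unitalBanachAlgType R[i]) (phi : forall i : nat, {lrmorphism S i -> L}) :
  is_inductive_limit phi ->
  exists theta : {lrmorphism L -> Asy S}, forall x : L, `|theta x| = `|x|.
Proof.
move=> phi_lim; have [phi_comp univ] := phi_lim.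
have [theta [theta_contr theta_phi _]] := univ _ _ (tail_class_compatible S).
exists theta => x; rewrite !rnormE; congr _%:C; apply: le_anti; rewrite theta_contr /=.
(* The distance from [x] to [phi i a] is paid twice, once in [L] and once after applying [theta],
   hence [e / 2]. *)
apply/ler_addgt0Pr => e e0; have e2 : 0 < e / 2 by rewrite divr_gt0.
have /asboolP/(_ _ e2)[_ /asboolP[i [a ->]] xa] := images_dense phi_lim x.
have phi_le : rnorm (phi i a) <= rnorm (theta (phi i a)).
  rewrite -lee_fin theta_phi; apply: le_trans (compatible_norm phi_comp a) _.
  by rewrite -tail_class_norm.
have phi_x : rnorm (theta (phi i a)) <= e / 2 + rnorm (theta x).
  rewrite -[phi i a](subKr x) rmorphB /=; apply: le_trans (rnormD _ _) _.
  by rewrite rnormN addrC lerD2r (le_trans (theta_contr _)) // ltW.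
rewrite -[leLHS](congr1 (@rnorm _ _) (subrK (phi i a) x)).
apply: le_trans (rnormD _ _) _; rewrite [e]splitr addrCA lerD ?(ltW xa) //.
by apply: le_trans phi_le _; rewrite addrC.
Qed.
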